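(* Let $n\ge 3$ be odd. Then $\{\mathcal{F}_C : C \text{ is a self-dual code in } \mathbb{F}_2^{n+1}\}$ is a partition of $\mathcal{SD}_n$; i.e. each $\mathcal{F}_C\subseteq\mathcal{SD}_n$, $\mathcal{F}_C\cap\mathcal{F}_{\widetilde C}=\emptyset$ for distinct self-dual codes $C\neq\widetilde C$, and every element of $\mathcal{SD}_n$ lies in some $\mathcal{F}_C$.
   Context: $\mathbb{F}_2$ is the binary field; $\mathrm{SGL}_n(\mathbb{F}_2)$ is the set of invertible symmetric $n\times n$ matrices over $\mathbb{F}_2$; $\Gamma_n$ is the graph on $\mathrm{SGL}_n(\mathbb{F}_2)$ with $A\sim B$ iff $\mathrm{rank}(A-B)=1$, $d$ its graph distance. $\mathcal{SD}_n=\{A\in\mathrm{SGL}_n(\mathbb{F}_2): d(A,I_n)=\frac{n+5}{2},\ \mathrm{rank}(A-I_n)=\frac{n+1}{2}\}$. A code $C\subseteq\mathbb{F}_2^{n+1}$ is self-dual if $C=C^\perp$ (standard dot product); then $\dim C=m:=\frac{n+1}{2}$. For $\mathbf{y}\in\mathbb{F}_2^{n+1}$, $\underline{\mathbf{y}}\in\mathbb{F}_2^n$ is $\mathbf{y}$ with its last entry deleted; $\mathbf{x}^2:=\mathbf{x}\mathbf{x}^{\top}$. Let $\mathfrak{B}_C$ be the set of bases of $C$, $\mathfrak{B}_C^2$ those bases containing an even number of vectors with last entry $1$. For $\mathcal{B}=\{\mathbf{y}_1,\ldots,\mathbf{y}_m\}\in\mathfrak{B}_C$ put $A'_{\mathcal{B}}=I_n+\sum_{i=1}^m\underline{\mathbf{y}_i}^2$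 and $A''_{\mathcal{B}}=I_n+\sum_{i=1}^m\underline{\mathbf{y}_i}^2+(\underline{\mathbf{y}_1}+\cdots+\underline{\mathbf{y}_m})^2$. Define $\mathcal{F}_C=\{A'_{\mathcal{B}}:\mathcal{B}\in\mathfrak{B}_C^2\}\cup\{A''_{\mathcal{B}}:\mathcal{B}\in\mathfrak{B}_C\}$ if $m$ is even, and $\mathcal{F}_C=\{A'_{\mathcal{B}}:\mathcal{B}\in\mathfrak{B}_C^2\}$ if $m$ is odd. *)

(* Defs.v *)
From mathcomp Require Import all_boot all_order all_algebra.
Set Implicit Arguments. Unset Strict Implicit. Unset Printing Implicit Defensive.
Import GRing.Theory.
Local Open Scope ring_scope.

Notation F2 := 'F_2.

Definition sgl (n : nat) (A : 'M[F2]_n) : bool := (A^T == A) && (A \in unitmx).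

Fixpoint walk (n k : nat) (A B : 'M[F2]_n) : Prop :=
  match k with
  | 0 => A = B
  | k'.+1 => exists C : 'M[F2]_n, sgl C /\ \rank (A - C) = 1%N /\ walk k' C B
  end.

Definition gdist_is (n : nat) (A B : 'M[F2]_n) (k : nat) : Prop :=
  walk k A B /\ forall j, (j < k)%N -> ~ walk j A B.

Definition in_SD (n : nat) (A : 'M[F2]_n) : Prop :=
  sgl A /\ gdist_is A 1%:M (n + 5)./2 /\ \rank (A - 1%:M) = (n + 1)./2.

Definition dotv (N : nat) (x y : 'rV[F2]_N) : F2 := (x *m y^T) 0 0.

Definition dual_code (N : nat) (C : {set 'rV[F2]_N}) : {set 'rV[F2]_N} :=
  [set y | [forall x in C, dotv x y == 0]].

Definition self_dual (N : nat) (C : {set 'rV[F2]_N}) : Prop := C = dual_code C.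

Definition under (n : nat) (y : 'rV[F2]_n.+1) : 'rV[F2]_n :=
  \row_(j < n) y 0 (widen_ord (leqnSn n) j).

(* x^2 := x x^T, x a (column) vector of F_2^n *)
Definition vsq (n : nat) (x : 'rV[F2]_n) : 'M[F2]_n := x^T *m x.

Definition fam_mx (m N : nat) (B : 'I_m -> 'rV[F2]_N) : 'M[F2]_(m, N) :=
  \matrix_(i < m) B i.

Definition is_basis (m N : nat) (C : {set 'rV[F2]_N}) (B : 'I_m -> 'rV[F2]_N) : Prop :=
  row_free (fam_mx B) /\ (forall y : 'rV[F2]_N, y \in C <-> (y <= fam_mx B)%MS).

Definition even_last (m n : nat) (B : 'I_m -> 'rV[F2]_n.+1) : bool :=
  ~~ odd #|[set i : 'I_m | B i 0 ord_max == 1]|.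

Definition A1 (m n : nat) (B : 'I_m -> 'rV[F2]_n.+1) : 'M[F2]_n :=
  1%:M + \sum_(i < m) vsq (under (B i)).

Definition A2 (m n : nat) (B : 'I_m -> 'rV[F2]_n.+1) : 'M[F2]_n :=
  1%:M + \sum_(i < m) vsq (under (B i)) + vsq (\sum_(i < m) under (B i)).

Definition in_FC (n : nat) (C : {set 'rV[F2]_n.+1}) (A : 'M[F2]_n) : Prop :=
  let m := (n + 1)./2 in
  (exists B : 'I_m -> 'rV[F2]_n.+1, is_basis C B /\ even_last B /\ A = A1 B)
  \/ (~~ odd m /\ exists B : 'I_m -> 'rV[F2]_n.+1, is_basis C B /\ A = A2 B).

(* Main.v *)
Require Import Defs.
From mathcomp Require Import all_boot all_order all_algebra.
Set Implicit Arguments. Unset Strict Implicit. Unset Printing Implicit Defensive.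
Import GRing.Theory.
Local Open Scope ring_scope.

(* Put m = (n + 1) / 2 and A = I + D.  A walk of length k from A to I amounts to a
   decomposition D = z_1^2 + ... + z_k^2 all of whose partial sums stay invertible after
   adding I.  Call the row space U of D flat if u.v = (u.u)(v.v) on U; equivalently, appending
   the parity bit u.u to every u in U gives a self-orthogonal code.  The matrices of SD_n turn
   out to be the invertible symmetric A such that D has rank m and U is flat, and the parity
   extension of U is then the only self-dual code C with A in F_C.

   Upper bounds on the distance come from a single induction.  Let D = T^T T, where T has k
   rows; then I + D is invertible if and only if H = I + T T^T is.  Let y be a unit vector
   with y H^-1 y^T = 1, and let the rows of Q be an orthonormal basis of its orthogonal
   complement.  Replacing T by Q T removes the square (y T)^2 from D and restricts H to that
   complement, where it is still nondegenerate.  Excluding at most five vectors y keeps H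
   nonalternating and T nonflat (k = 3 needs a separate argument), so the process goes on and
   yields a walk of length at most k.  A symmetric D of rank r admits such a T with r + 1
   rows, so the distance is at most r + 1 when U is not flat.  When U is flat of dimension m,
   step first to A + z^2 with z outside U: by maximality U + <z> is not flat, a T with m + 1
   rows still exists, and the distance is at most m + 2.

   Conversely, let U be flat of dimension m.  In a walk of length at most m + 1 all z_i lie in
   U, and the first z_i of odd weight, counted from I, would be a kernel vector of the partial
   sum it completes; but U contains the all-ones vector, of odd weight.

   Finally, over F_2 a symmetric D of rank m is a sum of m squares y_i^2 or, when it is
   alternating, of m squares y_i^2 and (y_1 + ... + y_m)^2. *)

Lemma odd_succ_double n r : n.+1 = (r + r)%N -> odd n.
Proof. by move=> n_r; rewrite -[odd n]negbK -oddS n_r addnn odd_double. Qed.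

Lemma double_half_odd n : odd n -> n.+1 = ((n + 1)./2 + (n + 1)./2)%N.
Proof. by move=> odd_n; rewrite addnn -addn1 even_halfK // oddD odd_n. Qed.

Lemma unit_1addmxC (F : fieldType) m n (A : 'M[F]_(m, n)) (B : 'M[F]_(n, m)) :
  1%:M + B *m A \in unitmx -> 1%:M + A *m B \in unitmx.
Proof.
rewrite -!row_free_unit => freeBA; apply: inj_row_free => c.
rewrite mulmxDr mulmx1 mulmxA => cAB0.
have /eqP cA0 : c *m A == 0.
  by rewrite -(mulmx_free_eq0 _ freeBA) mulmxDr mulmx1 mulmxA -mulmxDl cAB0 mul0mx.
by rewrite cA0 mul0mx addr0 in cAB0.
Qed.

Lemma sub_col_mx (F : fieldType) m1 m2 n (A : 'M[F]_(m1, n)) (B : 'M[F]_(m2, n)) :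
  (A <= col_mx A B)%MS /\ (B <= col_mx A B)%MS.
Proof. by apply/andP; rewrite -col_mx_sub. Qed.

Lemma symmetric_entry (T : Type) n (A : 'M[T]_n) i j : A^T = A -> A i j = A j i.
Proof. by move=> {1}<-; rewrite mxE. Qed.

Lemma symmetric_add (V : nmodType) n (A B : 'M[V]_n) :
  A^T = A -> B^T = B -> (A + B)^T = A + B.
Proof. by move=> symA symB; rewrite raddfD /= symA symB. Qed.

Lemma symmetric_mul_tr (R : comPzRingType) m n (T : 'M[R]_(m, n)) :
  (T *m T^T)^T = T *m T^T.
Proof. by rewrite trmx_mul trmxK. Qed.

Lemma symmetric_congr (R : comPzRingType) m n (P : 'M[R]_(m, n)) (K : 'M[R]_n) :
  K^T = K -> (P *m K *m P^T)^T = P *m K *m P^T.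
Proof. by move=> symK; rewrite !trmx_mul trmxK symK mulmxA. Qed.

Lemma symmetric_invmx (R : comUnitRingType) n (K : 'M[R]_n) :
  K^T = K -> (invmx K)^T = invmx K.
Proof. by rewrite trmx_inv => ->. Qed.

Lemma congr_unit_eqmx (F : fieldType) m n (Y : 'M[F]_(m, n)) K : row_free Y -> K \in unitmx ->
  (Y^T *m K *m Y :=: Y)%MS.
Proof.
move=> freeY uK; apply/eqmxP; have le : (Y^T *m K *m Y <= Y)%MS by rewrite submxMl.
have [_ eq_rk] := mxrank_leqif_sup le; rewrite le -eq_rk mxrankMfree //.
by rewrite mxrankMfree ?row_free_unit // mxrank_tr eqxx.
Qed.

Lemma orthogonal_notin (F : fieldType) m n (D : 'M[F]_(m, n)) (h u : 'rV_n) :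
    (u <= D)%MS -> u *m h^T != 0 -> (\rank D < n)%N ->
  exists2 z : 'rV_n, z *m h^T = 0 & ~~ (z <= D)%MS.
Proof.
move=> uD uh ltDn; case: (boolP (kermx h^T <= D)%MS) => [leD | /row_subPn[i nD]]; last first.
  by exists (row i (kermx h^T)); rewrite // -row_mul mulmx_ker row0.
have [_ leDker] := mxrank_leqif_sup leD; case/eqP: uh; apply/sub_kermxP.
apply: submx_trans uD _; rewrite -leDker eqn_leq mxrankS // mxrank_ker mxrank_tr.
rewrite (leq_trans _ (leq_sub2l n (rank_leq_row h))) // subn1 -ltnS prednK //.
exact: leq_ltn_trans ltDn.
Qed.

Lemma self_orthogonal_ker (F : fieldType) m n (M : 'M[F]_(m, n)) :
  M *m M^T = 0 -> n = (\rank M + \rank M)%N -> (kermx M^T :=: M)%MS.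
Proof.
move=> MM rkM; have leM : (M <= kermx M^T)%MS by apply/sub_kermxP.
apply/eqmxP; rewrite andbC leM -(mxrank_leqif_sup leM).2 mxrank_ker mxrank_tr /=.
by apply/eqP; rewrite -[LHS](addnK (\rank M)) -rkM.
Qed.

Lemma symmetric_rank_factor (F : fieldType) n r (D : 'M[F]_n) :
    D^T = D -> \rank D = r ->
  exists X : 'M_(r, n), exists S : 'M_r,
    [/\ D = X^T *m S *m X, row_free X, S^T = S & S \in unitmx].
Proof.
move=> symD rkD.
have: exists2 X : 'M_(\rank D, n), row_free X & (X :=: D)%MS.
  by exists (row_base D); [apply: row_base_free | apply: eq_row_base].
rewrite rkD => -[X freeX eqX]; have /row_freeP[R XR] := freeX.
have DRX : D *m (R *m X) = D.
  have /submxP[C ->] : (D <= X)%MS by rewrite eqX.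
  by rewrite -mulmxA (mulmxA X) XR mul1mx.
have DE : D = X^T *m (R^T *m D *m R) *m X.
  have -> : X^T *m (R^T *m D *m R) *m X = (R *m X)^T *m (D *m (R *m X)).
    by rewrite trmx_mul !mulmxA.
  by rewrite DRX -{2}symD -trmx_mul DRX symD.
exists X, (R^T *m D *m R); split=> //.
- by rewrite !trmx_mul trmxK symD mulmxA.
rewrite -row_free_unit -row_leq_rank -{1}rkD {1}DE.
exact: leq_trans (mxrankM_maxl _ _) (mxrankM_maxr _ _).
Qed.

Lemma affine_solution_notin (F : finFieldType) k p (W : 'M[F]_(k, p)) (x0 : 'rV[F]_k)
    (s : seq 'rV[F]_k) :
  (size s < #|F| ^ (k - p))%N -> exists2 x, x *m W = x0 *m W & x \notin s.
Proof.
move=> lt_s; pose f (c : 'rV_(\rank (kermx W))) := x0 + c *m row_base (kermx W).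
have f_inj : injective f by move=> c d /addrI /(row_free_inj (row_base_free _)).
case: (pickP (fun c => f c \notin s)) => [c fc | fs].
  exists (f c) => //; rewrite mulmxDl (_ : c *m _ *m W = 0) ?addr0 //.
  by apply/sub_kermxP; rewrite -(eq_row_base (kermx W)) submxMl.
have sub_s : {subset codom f <= s} by move=> _ /codomP[c ->]; move/negbFE: (fs c).
have /injectiveP uniq_f := f_inj; have := uniq_leq_size uniq_f sub_s.
rewrite size_codom card_mx mul1n leqNgt (leq_trans lt_s) //.
apply: leq_pexp2l; first exact: ltnW (card_finNzRing_gt1 F).
by rewrite mxrank_ker leq_sub2l ?rank_leq_col.
Qed.

(** * Symmetric matrices over the binary field *)

Lemma F2P (a : F2) : a = 0 \/ a = 1.
Proof. by case: a => [[|[|a]] // lt_a]; [left | right]; apply: val_inj. Qed.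

Lemma F2_pchar : 2 \in [pchar F2].
Proof. exact: pchar_Fp. Qed.

Lemma F2_addxx (a : F2) : a + a = 0.
Proof. exact: addrr_pchar2 F2_pchar a. Qed.

Lemma F2_mulxx (a : F2) : a * a = a.
Proof. by case: (F2P a) => ->; rewrite ?mulr0 ?mulr1. Qed.

Lemma F2_addr_eq0 (a b : F2) : (a + b == 0) = (a == b).
Proof. by rewrite addr_eq0 (oppr_pchar2 F2_pchar). Qed.

Lemma F2_neq0 (a : F2) : (a != 0) = (a == 1).
Proof. by case: (F2P a) => ->. Qed.

Lemma F2_natr k : k%:R = (odd k)%:R :> F2.
Proof.
by rewrite -{1}(odd_double_half k) natrD -mul2n natrM pchar_Fp_0 // mul0r addr0.
Qed.

Lemma oppmx_F2 m n (A : 'M[F2]_(m, n)) : - A = A.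
Proof. by apply/matrixP => i j; rewrite mxE (oppr_pchar2 F2_pchar). Qed.

Lemma addmxx_F2 m n (A : 'M[F2]_(m, n)) : A + A = 0.
Proof. by rewrite -{2}[A]oppmx_F2 subrr. Qed.

Lemma addmx_eq0_F2 m n (A B : 'M[F2]_(m, n)) : (A + B == 0) = (A == B).
Proof. by rewrite addr_eq0 oppmx_F2. Qed.

Lemma addmxK_F2 m n (A B : 'M[F2]_(m, n)) : A + B + B = A.
Proof. by rewrite -addrA addmxx_F2 addr0. Qed.

Lemma dotvC n (u v : 'rV[F2]_n) : dotv u v = dotv v u.
Proof. by rewrite /dotv -[in LHS](trmxK u) -trmx_mul mxE. Qed.

Lemma dotvDl n (u v w : 'rV[F2]_n) : dotv (u + v) w = dotv u w + dotv v w.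
Proof. by rewrite /dotv mulmxDl mxE. Qed.

Lemma dotvZl n a (u v : 'rV[F2]_n) : dotv (a *: u) v = a * dotv u v.
Proof. by rewrite /dotv -scalemxAl mxE. Qed.

Lemma dot0v n (v : 'rV[F2]_n) : dotv 0 v = 0.
Proof. by rewrite /dotv mul0mx mxE. Qed.

Lemma dotv0 n (v : 'rV[F2]_n) : dotv v 0 = 0.
Proof. by rewrite dotvC dot0v. Qed.

Lemma dotv_mull m n (u : 'rV[F2]_m) (A : 'M_(m, n)) v :
  dotv (u *m A) v = dotv u (v *m A^T).
Proof. by rewrite /dotv trmx_mul trmxK mulmxA. Qed.

Lemma dotv_sum n (u v : 'rV[F2]_n) : dotv u v = \sum_i u 0 i * v 0 i.
Proof. by rewrite /dotv mxE; apply: eq_bigr => i _; rewrite mxE. Qed.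

Lemma dotv_delta n (u : 'rV[F2]_n) i : dotv u 'e_i = u 0 i.
Proof. by rewrite /dotv trmx_delta -colE mxE. Qed.

Lemma dotv_inj n (u v : 'rV[F2]_n) : (forall w, dotv u w = dotv v w) -> u = v.
Proof. by move=> eq_uv; apply/rowP => i; rewrite -!dotv_delta. Qed.

Lemma mulmx_tr_rV n (u v : 'rV[F2]_n) : u *m v^T = (dotv u v)%:M.
Proof. exact: mx11_scalar. Qed.

Lemma mulmx_tr_entry m p n (A : 'M[F2]_(m, n)) (B : 'M_(p, n)) i j :
  (A *m B^T) i j = dotv (row i A) (row j B).
Proof. by rewrite dotv_sum mxE; apply: eq_bigr => h _; rewrite !mxE. Qed.

(* The off-diagonal terms of a symmetric double sum cancel in pairs. *)
Lemma sum_symmetric k (f : 'I_k -> 'I_k -> F2) :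
  (forall i j, f i j = f j i) -> \sum_i \sum_j f i j = \sum_i f i i.
Proof.
elim: k f => [|k IHk] f symf; first by rewrite !big_ord0.
rewrite big_ord_recl [RHS]big_ord_recl big_ord_recl -addrA; congr (_ + _).
under [X in _ + X]eq_bigr => i _ do rewrite big_ord_recl symf.
rewrite big_split /= addrA F2_addxx add0r.
by apply: IHk => i j; apply: symf.
Qed.

Definition diagv (T : Type) k (K : 'M[T]_k) : 'rV[T]_k := \row_i K i i.

Lemma diagvD (V : nmodType) k (K L : 'M[V]_k) : diagv (K + L) = diagv K + diagv L.
Proof. by apply/rowP => i; rewrite !mxE. Qed.

Lemma diagv1 (R : pzSemiRingType) k : diagv 1%:M = const_mx 1 :> 'rV[R]_k.
Proof. by apply/rowP => i; rewrite !mxE eqxx. Qed.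

Lemma diagv_block (T : Type) k l (A : 'M[T]_k) B (C : 'M[T]_(l, k)) D :
  diagv (block_mx A B C D) = row_mx (diagv A) (diagv D).
Proof.
apply/rowP => i; rewrite [LHS]mxE; case: (split_ordP i) => j ->.
  by rewrite block_mxEul row_mxEl mxE.
by rewrite block_mxEdr row_mxEr mxE.
Qed.

Lemma mxtrace_diagv k (K : 'M[F2]_k) : \tr K = dotv (diagv K) (const_mx 1).
Proof. by rewrite dotv_sum; apply: eq_bigr => i _; rewrite !mxE mulr1. Qed.

Lemma diagv_vsq k (z : 'rV[F2]_k) : diagv (vsq z) = z.
Proof. by apply/rowP => i; rewrite !mxE big_ord1 mxE F2_mulxx. Qed.

Lemma dotv_diagv k (K : 'M[F2]_k) u : K^T = K -> dotv (u *m K) u = dotv u (diagv K).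
Proof.
move=> symK; rewrite !dotv_sum.
under eq_bigr => j _ do rewrite mxE big_distrl /=.
rewrite (sum_symmetric (f := fun j i => u 0 i * K i j * u 0 j)).
  by apply: eq_bigr => i _; rewrite mxE mulrAC F2_mulxx.
by move=> i j; rewrite -[in LHS]symK mxE mulrAC [RHS]mulrAC (mulrC (u 0 i)).
Qed.

Lemma dotvv n (u : 'rV[F2]_n) : dotv u u = dotv u (const_mx 1).
Proof. by rewrite -diagv1 -dotv_diagv ?trmx1 // mulmx1. Qed.

Lemma dotv_const1 n : dotv (const_mx 1 : 'rV_n) (const_mx 1) = n%:R.
Proof.
rewrite dotv_sum; under eq_bigr => i _ do rewrite !mxE mulr1.
by rewrite sumr_const card_ord.
Qed.

Lemma diagv_congr k l (P : 'M[F2]_(l, k)) (K : 'M[F2]_k) :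
  K^T = K -> diagv (P *m K *m P^T) = diagv K *m P^T.
Proof.
move=> symK; apply/rowP => i; rewrite mxE mulmx_tr_entry row_mul dotv_diagv //.
by rewrite mulmx_tr_entry dotvC; congr dotv; apply/rowP => j; rewrite !mxE.
Qed.

Lemma diagv_mul_tr k l (T : 'M[F2]_(k, l)) : diagv (T *m T^T) = const_mx 1 *m T^T.
Proof. by rewrite -{1}[T]mulmx1 diagv_congr ?trmx1 ?diagv1. Qed.

Lemma diagv_invmx k (K : 'M[F2]_k) : K^T = K -> K \in unitmx ->
  diagv (invmx K) = diagv K *m invmx K.
Proof.
move=> symK uK; rewrite -{2}(symmetric_invmx symK) -diagv_congr //.
by rewrite mulVmx // mul1mx symmetric_invmx.
Qed.

Lemma diagv_invmx_neq0 k (K : 'M[F2]_k) : K^T = K -> K \in unitmx ->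
  diagv K != 0 -> diagv (invmx K) != 0.
Proof.
move=> symK uK; apply: contra_neq => dV0.
by rewrite -[diagv K](mulmxKV uK) -diagv_invmx // dV0 mul0mx.
Qed.

(* The trace of [K *m invmx K] only sees the diagonals, by symmetry. *)
Lemma dotv_diagv_invmx k (K : 'M[F2]_k) : K^T = K -> K \in unitmx ->
  dotv (diagv K) (diagv (invmx K)) = k%:R.
Proof.
move=> symK uK; rewrite -(mxtrace1 _ k) -(mulmxV uK) /mxtrace.
under [RHS]eq_bigr => i _ do rewrite mxE.
rewrite (sum_symmetric (f := fun i j => K i j * invmx K j i)).
  by rewrite dotv_sum; apply: eq_bigr => i _; rewrite !mxE.
by move=> i j; rewrite symmetric_entry // [invmx K j i]symmetric_entry // symmetric_invmx.
Qed.

Lemma alternating_unit_even k (K : 'M[F2]_k) : K^T = K -> K \in unitmx ->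
  diagv K = 0 -> ~~ odd k.
Proof.
move=> symK uK K0; have := dotv_diagv_invmx symK uK.
by rewrite K0 dot0v F2_natr; case: (odd k).
Qed.

Lemma vsq_sym n (z : 'rV[F2]_n) : (vsq z)^T = vsq z.
Proof. by rewrite trmx_mul trmxK. Qed.

Lemma mul_vsq n (v z : 'rV[F2]_n) : v *m vsq z = dotv v z *: z.
Proof. by rewrite mulmxA mulmx_tr_rV mul_scalar_mx. Qed.

Lemma vsq_mul m n (v : 'rV[F2]_m) (A : 'M[F2]_(m, n)) : vsq (v *m A) = A^T *m vsq v *m A.
Proof. by rewrite /vsq trmx_mul !mulmxA. Qed.

Lemma rank_vsq n (z : 'rV[F2]_n) : z != 0 -> \rank (vsq z) = 1%N.
Proof.
move=> nz; apply/eqP; rewrite eqn_leq (leq_trans (mxrankM_maxr _ _) (rank_leq_row _)).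
rewrite lt0n mxrank_eq0; apply: contra_neq nz => vsq0.
by rewrite -[z]diagv_vsq vsq0; apply/rowP => i; rewrite !mxE.
Qed.

Lemma symmetric_rank1 n (D : 'M[F2]_n) : D^T = D -> \rank D = 1%N -> exists z, D = vsq z.
Proof.
move=> symD /(symmetric_rank_factor symD)[X [S [-> _ _ uS]]]; exists X.
suff -> : S = 1%:M by rewrite mulmx1.
move: uS; rewrite [S]mx11_scalar unitmxE det_scalar expr1 unitfE.
by rewrite F2_neq0 => /eqP ->.
Qed.

Lemma unit_add_vsq n (A : 'M[F2]_n) z : A^T = A -> A \in unitmx ->
  dotv z (diagv (invmx A)) = 0 -> A + vsq z \in unitmx.
Proof.
move=> symA uA Az; rewrite -row_free_unit; apply: inj_row_free => v.
rewrite mulmxDr mul_vsq => /eqP; rewrite addmx_eq0_F2 => /eqP vA.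
have vE : v = dotv v z *: (z *m invmx A) by rewrite scalemxAl -vA mulmxK.
have vz : dotv v z = 0.
  by rewrite vE dotvZl dotv_diagv ?symmetric_invmx // Az mulr0.
by rewrite vE vz scale0r.
Qed.

(** * Orthonormal bases *)

Lemma orthogonal_basis_extension k (K : 'M[F2]_(1 + k)) x : dotv (x *m K) x = 1 ->
  exists2 N : 'M_(k, 1 + k), col_mx x N \in unitmx & x *m K *m N^T = 0.
Proof.
move=> Kxx; have nzKx : (x *m K)^T != 0.
  by apply: contra_eq_neq Kxx => Kx0; rewrite -[x *m K]trmxK Kx0 trmx0 dot0v.
have rk_ker : \rank (kermx (x *m K)^T) = k.
  by rewrite mxrank_ker mxrank_tr rank_rV -trmx_eq0 nzKx subn1.
have: exists2 N : 'M_(\rank (kermx (x *m K)^T), 1 + k),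
    row_free N & (N <= kermx (x *m K)^T)%MS.
  by exists (row_base (kermx (x *m K)^T)); rewrite ?row_base_free ?eq_row_base.
rewrite rk_ker => -[N freeN /sub_kermxP NKx].
exists N; last by rewrite -[x *m K]trmxK -trmx_mul NKx trmx0.
rewrite -row_free_unit; apply: inj_row_free => c.
rewrite -[c]hsubmxK mul_row_col [lsubmx c]mx11_scalar mul_scalar_mx.
move: (lsubmx c 0 0) (rsubmx c) => a b cP.
have a0 : a = 0.
  have := congr1 (mulmx^~ (x *m K)^T) cP.
  rewrite mulmxDl -mulmxA NKx mulmx0 addr0 -scalemxAl mulmx_tr_rV dotvC Kxx scale_scalar_mx.
  by rewrite mulr1 mul0mx => /matrixP/(_ 0 0); rewrite !mxE.
move: cP; rewrite a0 scale0r add0r => /eqP; rewrite mulmx_free_eq0 // => /eqP ->.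
by rewrite raddf0 row_mx0.
Qed.

(* [diagv K *m invmx K] is the characteristic vector [z] of the form, given by
   K(u, z) = K(u, u); the orthogonal complement of [x <> z] is not alternating. *)
Lemma orthogonal_splitting k (K : 'M[F2]_(1 + k)) x : K^T = K -> K \in unitmx ->
    dotv (x *m K) x = 1 ->
  exists N : 'M_(k, 1 + k), exists L : 'M_k,
    [/\ col_mx x N *m K *m (col_mx x N)^T = block_mx 1%:M 0 0 L,
        L^T = L, L \in unitmx & x *m K != diagv K -> diagv L != 0].
Proof.
move=> symK uK Kxx; have [N uN xKN] := orthogonal_basis_extension Kxx.
have blockL : col_mx x N *m K *m (col_mx x N)^T = block_mx 1%:M 0 0 (N *m K *m N^T).
  have NKx : N *m K *m x^T = 0.
    by apply: (can_inj (@trmxK _ _ _)); rewrite trmx0 !trmx_mul trmxK symK mulmxA.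
  by rewrite mul_col_mx tr_col_mx mul_col_row xKN NKx mulmx_tr_rV Kxx.
exists N, (N *m K *m N^T); split=> //; first exact: symmetric_congr.
  have := block_diag_mx_unit (1%:M : 'M_1) (N *m K *m N^T).
  by rewrite -blockL unitmx1 !unitmx_mul unitmx_tr uN uK.
apply: contra_neq => L0; have uNT : (col_mx x N)^T \in unitmx by rewrite unitmx_tr.
apply: (can_inj (mulmxK uNT)); rewrite -diagv_congr // blockL diagv_block L0.
rewrite tr_col_mx mul_mx_row xKN mulmx_tr_rV Kxx; congr row_mx.
by apply/rowP => i; rewrite ord1 !mxE.
Qed.

Lemma unit_vector_neq_diagv k (K : 'M[F2]_(1 + k)) :
    K^T = K -> K \in unitmx -> diagv K != 0 ->
  exists2 x, dotv (x *m K) x = 1 & (k == 0%N) || (x *m K != diagv K).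
Proof.
move=> symK uK /rV0Pn[i Kii].
have Ki : dotv 'e_i (diagv K) = 1 by apply/eqP; rewrite dotvC dotv_delta -F2_neq0.
have [k0 | k_gt0] := posnP k.
  by exists 'e_i; [rewrite dotv_diagv | apply/orP; left; apply/eqP].
have [|x xW] := @affine_solution_notin _ _ 1 (diagv K)^T 'e_i [:: diagv K *m invmx K].
  by rewrite card_Fp // subSS subn0 (@ltn_exp2l 2 0).
rewrite inE => neqx; exists x; first by rewrite dotv_diagv // /dotv xW.
by apply/orP; right; apply: contra_neq neqx => <-; rewrite mulmxK.
Qed.

Lemma orthonormal_completion k (K : 'M[F2]_(1 + k)) x : K^T = K -> K \in unitmx ->
    dotv (x *m K) x = 1 -> (k == 0%N) || (x *m K != diagv K) ->
  exists Q : 'M_(k, 1 + k), col_mx x Q *m K *m (col_mx x Q)^T = 1%:M.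
Proof.
elim: k => [|k IHk] in K x * => symK uK Kxx neqx.
all: have [N [L [NKN symL uL nzL]]] := orthogonal_splitting symK uK Kxx.
  by exists N; rewrite NKN [RHS](@scalar_mx_block _ 1 0); congr block_mx; apply/matrixP => -[].
have [x' Lx' neqx'] := unit_vector_neq_diagv symL uL (nzL neqx).
have [Q QL] := IHk L x' symL uL Lx' neqx'; exists (col_mx x' Q *m N).
have -> : col_mx x (col_mx x' Q *m N) = block_mx 1%:M 0 0 (col_mx x' Q) *m col_mx x N.
  by rewrite mul_block_col !mul0mx mul1mx addr0 add0r.
set R := block_mx _ _ _ _; rewrite trmx_mul -!mulmxA (mulmxA _ K) (mulmxA (_ *m K)) NKN.
rewrite tr_block_mx !mulmx_block !(mul0mx, mulmx0, mul1mx, mulmx1, trmx0, trmx1, addr0, add0r).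
by rewrite mulmxA QL [RHS](@scalar_mx_block _ 1 k.+1).
Qed.

Lemma unit_nonalternating_gram k (K : 'M[F2]_k) : K^T = K -> K \in unitmx -> diagv K != 0 ->
  exists R : 'M_k, K = R^T *m R.
Proof.
case: k => [|k] in K * => symK uK nzK; first by case/rV0Pn: nzK => -[].
have [x Kxx neqx] := @unit_vector_neq_diagv k K symK uK nzK.
have [Q] := @orthonormal_completion k K x symK uK Kxx neqx.
move: (col_mx x Q : 'M_k.+1) => P PKP.
have uP : P \in unitmx by have := unitmx1 F2 k.+1; rewrite -PKP !unitmx_mul => /andP[/andP[]].
exists (invmx P)^T; rewrite trmxK trmx_inv -[invmx P]mulmx1 -PKP !mulmxA mulVmx // mul1mx.
by rewrite mulmxK ?unitmx_tr.
Qed.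

Definition alternating_part k (G : 'M[F2]_k) : 'M[F2]_k := G + vsq (diagv G).

Lemma alternating_partE k (G : 'M[F2]_k) i j :
  alternating_part G i j = G i j + G i i * G j j.
Proof. by rewrite !mxE big_ord1 !mxE. Qed.

Lemma symmetric_alternating_part k (G : 'M[F2]_k) :
  G^T = G -> (alternating_part G)^T = alternating_part G.
Proof. by move=> symG; rewrite symmetric_add ?vsq_sym. Qed.

Lemma diagv_alternating_part k (G : 'M[F2]_k) : diagv (alternating_part G) = 0.
Proof. by rewrite diagvD diagv_vsq addmxx_F2. Qed.

Lemma alternating_part_congr k l (P : 'M[F2]_(l, k)) (G : 'M[F2]_k) : G^T = G ->
  alternating_part (P *m G *m P^T) = P *m alternating_part G *m P^T.
Proof.
by move=> symG; rewrite /alternating_part diagv_congr // vsq_mul trmxK mulmxDr mulmxDl.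
Qed.

(** * Restriction to an orthonormal hyperplane *)

Section OrthonormalHyperplane.

Variables (k : nat) (y : 'rV[F2]_(1 + k)) (Q : 'M[F2]_(k, 1 + k)).
Hypothesis orthoyQ : col_mx y Q *m (col_mx y Q)^T = 1%:M.

Lemma orthonormal_rows : Q *m y^T = 0 /\ Q *m Q^T = 1%:M.
Proof.
move: orthoyQ; rewrite tr_col_mx mul_col_row [RHS](@scalar_mx_block _ 1 k).
by case/eq_block_mx.
Qed.

Lemma orthonormal_columns : vsq y + Q^T *m Q = 1%:M.
Proof. by rewrite /vsq -mul_row_col -tr_col_mx; apply: mulmx1C. Qed.

Lemma mul_orthonormal_columns m (A : 'M_(m, 1 + k)) : A *m Q^T *m Q = A + A *m vsq y.
Proof.
by rewrite -{2}[A]mulmx1 -orthonormal_columns mulmxDr mulmxA addrAC addmxx_F2 add0r.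
Qed.

Lemma hyperplane_unitmx (H : 'M_(1 + k)) : H \in unitmx -> dotv (y *m invmx H) y = 1 ->
  Q *m H *m Q^T \in unitmx.
Proof.
have [Qy QQ] := orthonormal_rows => uH Hy.
rewrite -row_free_unit; apply: inj_row_free => c; rewrite !mulmxA => cQHQ.
have vy : c *m Q *m H = dotv (c *m Q *m H) y *: y.
  by apply/eqP; rewrite -mul_vsq -addmx_eq0_F2 -mul_orthonormal_columns cQHQ mul0mx.
have cQ : c *m Q = dotv (c *m Q *m H) y *: (y *m invmx H).
  by rewrite scalemxAl -vy mulmxK.
have cQ0 : c *m Q = 0.
  suff v0 : dotv (c *m Q *m H) y = 0 by rewrite cQ v0 scale0r.
  rewrite -[LHS]mulr1 -Hy -dotvZl -cQ.
  by rewrite /dotv -mulmxA Qy mulmx0 mxE.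
by rewrite -[c]mulmx1 -QQ mulmxA cQ0 mul0mx.
Qed.

Lemma hyperplane_diagv_neq0 (H : 'M_(1 + k)) :
  H^T = H -> diagv H != 0 -> diagv H != y -> diagv (Q *m H *m Q^T) != 0.
Proof.
move=> symH nz; apply: contra_neq; rewrite diagv_congr // => H0.
have: diagv H = dotv (diagv H) y *: y.
  by apply/eqP; rewrite -mul_vsq -addmx_eq0_F2 -mul_orthonormal_columns H0 mul0mx.
case: (F2P (dotv (diagv H) y)) => ->; rewrite ?scale0r ?scale1r // => dH0.
by rewrite dH0 eqxx in nz.
Qed.

Lemma hyperplane_add1_gram n (T : 'M_(1 + k, n)) :
  1%:M + Q *m T *m (Q *m T)^T = Q *m (1%:M + T *m T^T) *m Q^T.
Proof.
have [_ QQ] := orthonormal_rows.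
by rewrite mulmxDr mulmx1 mulmxDl QQ trmx_mul !mulmxA.
Qed.

Lemma tr_mul_orthonormal_split n (T : 'M_(1 + k, n)) :
  T^T *m T = (Q *m T)^T *m (Q *m T) + vsq (y *m T).
Proof.
rewrite vsq_mul trmx_mul mulmxA -(mulmxA _ Q^T) -mulmxDl -mulmxDr.
by rewrite addrC orthonormal_columns mulmx1.
Qed.

Lemma hyperplane_form_eq0 (B : 'M_(1 + k)) : dotv (y *m B) y = 0 -> Q *m B *m Q^T = 0 ->
  B = vsq y *m B + B *m vsq y.
Proof.
move=> By QBQ; apply/eqP.
have : (B + vsq y *m B) *m Q^T *m Q = 0.
  have -> : B + vsq y *m B = Q^T *m Q *m B.
    by rewrite -{1}[B]mul1mx -orthonormal_columns mulmxDl addrAC addmxx_F2 add0r.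
  by rewrite -!mulmxA (mulmxA Q) (mulmxA _ Q^T) QBQ !(mulmx0, mul0mx).
have yBy : vsq y *m B *m vsq y = 0.
  by rewrite -!mulmxA (mulmxA y) (mulmxA (y *m B)) mulmx_tr_rV By raddf0 mul0mx mulmx0.
rewrite mul_orthonormal_columns mulmxDl yBy addr0 -addrA => /eqP.
by rewrite addmx_eq0_F2.
Qed.

End OrthonormalHyperplane.

(* Each row of [B] lies in the plane spanned by [y] and [y *m B]. *)
Lemma vsq_splitting_candidates k (B : 'M[F2]_k) : B^T = B -> B != 0 ->
  exists2 s : seq 'rV_k, size s = 3 & forall y, B = vsq y *m B + B *m vsq y -> y \in s.
Proof.
move=> symB /matrix0Pn[i [j]]; rewrite F2_neq0 => /eqP Bij.
exists [:: row i B; row j B; row i B + row j B] => // y BE.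
have rowB h : row h B = y 0 h *: (y *m B) + dotv (row h B) y *: y.
  rewrite -mul_vsq {1}BE linearD /= (row_mul h (vsq y)) (row_mul h B); congr (_ + _).
  by rewrite [row h (vsq y)]rowE mul_vsq dotvC dotv_delta -scalemxAl.
have BijE : y 0 j * dotv (row i B) y + y 0 i * dotv (row j B) y = 1.
  have <- : dotv (row i B) 'e_j = 1 by rewrite dotv_delta mxE.
  rewrite [in RHS]rowB dotvDl !dotvZl dotv_mull symB -rowE dotv_delta.
  by rewrite addrC (dotvC y) [y 0 j * _]mulrC.
have yE : y = y 0 j *: row i B + y 0 i *: row j B.
  rewrite [row i B in RHS]rowB [row j B in RHS]rowB !scalerDr !scalerA addrACA.
  by rewrite [y 0 j * y 0 i]mulrC addmxx_F2 add0r -scalerDl BijE scale1r.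
move: BijE yE; case: (F2P (y 0 j)) => ->; case: (F2P (y 0 i)) => ->.
all: rewrite ?mul0r ?scale0r ?scale1r ?addr0 ?add0r.
- by move/eqP.
- by move=> _ ->; rewrite !inE eqxx orbT.
- by move=> _ ->; rewrite inE eqxx.
- by move=> _ ->; rewrite !inE eqxx !orbT.
Qed.

(** * Choice of the hyperplane *)

(* [const_mx 1] and [diagv H] are the characteristic vectors of the dot product and of the
   form [invmx H], respectively. *)
Definition noncharacteristic_unit_vector k (H : 'M[F2]_k) (y : 'rV[F2]_k) : bool :=
  [&& dotv y y == 1, dotv y (diagv (invmx H)) == 1, y != const_mx 1 & y != diagv H].

Lemma unit_vector_notin k (H : 'M[F2]_k) s : H^T = H -> H \in unitmx -> diagv H != 0 ->
    (size s < 2 ^ (k - 2))%N ->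
  exists y, [/\ dotv y y = 1, dotv y (diagv (invmx H)) = 1 & y \notin s].
Proof.
move=> symH uH nzH lt_s.
have /rV0Pn[i hi] := diagv_invmx_neq0 symH uH nzH.
have [|x] := @affine_solution_notin _ _ (1 + 1)
  (col_mx (const_mx 1) (diagv (invmx H)))^T 'e_i s; first by rewrite card_Fp.
rewrite tr_col_mx !mul_mx_row => /eq_row_mx[x1 xh] xs; exists x; split=> //.
  by rewrite dotvv /dotv x1 -/(dotv 'e_i _) dotvC dotv_delta mxE.
by rewrite /dotv xh -/(dotv 'e_i _) dotvC dotv_delta; apply/eqP; rewrite -F2_neq0.
Qed.

(* In even dimension the two characteristic vectors are not unit vectors, so only [s] has to be
   avoided. *)
Lemma noncharacteristic_unit_vector_notin k (H : 'M[F2]_k) s :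
    H^T = H -> H \in unitmx -> diagv H != 0 -> (size s + (odd k).*2 < 2 ^ (k - 2))%N ->
  exists2 y, noncharacteristic_unit_vector H y & y \notin s.
Proof.
move=> symH uH nzH; have [odd_k | even_k] := boolP (odd k); last rewrite addn0.
all: move=> lt_s.
  have [|y [yy yh]] := @unit_vector_notin _ H [:: const_mx 1, diagv H & s] symH uH nzH.
    by rewrite /= -addn2.
  rewrite !inE !negb_or => /and3P[y1 yd ys]; exists y => //.
  by rewrite /noncharacteristic_unit_vector yy yh y1 yd !eqxx.
have [y [yy yh ys]] := unit_vector_notin symH uH nzH lt_s; exists y => //.
rewrite /noncharacteristic_unit_vector yy yh !eqxx /=; apply/andP; split.
  by apply: contra_eq_neq yy => ->; rewrite dotv_const1 F2_natr (negPf even_k).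
by apply: contra_eq_neq yh => ->; rewrite dotv_diagv_invmx // F2_natr (negPf even_k).
Qed.

Lemma sum_ord3 (V : nmodType) (f : 'I_3 -> V) i p q : p != i -> q != i -> p != q ->
  \sum_j f j = f i + f p + f q.
Proof.
move=> pi qi pq; rewrite (bigD1 i) //= (bigD1 p) //= (bigD1 q) /=; last by rewrite qi eq_sym.
rewrite big_pred0 ?addr0 ?addrA // => j.
by case: i p q j pi qi pq => [[|[|[|?]]] ?] [[|[|[|?]]] ?] [[|[|[|?]]] ?] [[|[|[|?]]] ?].
Qed.

Section Symmetric3.

Variables (H : 'M[F2]_3) (i : 'I_3).
Hypotheses (symH : H^T = H) (uH : H \in unitmx).
Hypotheses (diagH : diagv H = 'e_i) (diagV : diagv (invmx H) = 'e_i).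

Let diagHE p : H p p = (p == i)%:R.
Proof. by have /rowP/(_ p) := diagH; rewrite !mxE. Qed.

Lemma symmetric3_offdiag p q : p != i -> q != i -> p != q -> H p i = 0 /\ H p q = 1.
Proof.
move=> pi qi pq; pose V := invmx H.
have VE r : V r r = (r == i)%:R by have /rowP/(_ r) := diagV; rewrite !mxE.
have HV r : H p i * V i r + H p p * V p r + H p q * V q r = (p == r)%:R.
  rewrite -(sum_ord3 (fun j => H p j * V j r)) //.
  by have /matrixP/(_ p r) := mulmxV uH; rewrite !mxE.
have HpiV : H p i * V i q = 0.
  have := HV q; rewrite diagHE VE (negPf pi) (negPf qi) (negPf pq).
  by rewrite mul0r mulr0 !addr0.
have Hpi : H p i = H p q * V i q.
  apply/eqP; rewrite -F2_addr_eq0; have := HV i; rewrite diagHE VE (negPf pi) eqxx.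
  by rewrite mul0r addr0 mulr1 (symmetric_entry q i (symmetric_invmx symH)) => ->.
have Hpi0 : H p i = 0 by rewrite -[LHS]F2_mulxx {2}Hpi mulrCA HpiV mulr0.
split=> //; have := HV p; rewrite Hpi0 diagHE (negPf pi) !mul0r !add0r eqxx.
by case: (F2P (H p q)) => ->; rewrite // mul0r => /eqP.
Qed.

Lemma symmetric3_column p : p != i -> H p i = 0.
Proof.
move=> pi; suff [q /andP[qi pq]] : exists q, (q != i) && (p != q).
  by have [] := symmetric3_offdiag pi qi pq.
have := cardC [in [:: i; p]]; rewrite card_ord; have := card_size [:: i; p].
case: (pickP [predC [:: i; p]]) => [q | none]; last first.
  by rewrite (eq_card0 none) addn0 => /[swap] ->.
by rewrite !inE negb_or => /andP[qi qp] _ _; exists q; rewrite qi eq_sym.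
Qed.

Lemma symmetric3_alternating_part_eq0 : alternating_part (1%:M + H) = 0.
Proof.
apply/matrixP => p q; rewrite [RHS]mxE.
have -> : alternating_part (1%:M + H) p q =
    (p == q)%:R + H p q + (1 + (p == i)%:R) * (1 + (q == i)%:R).
  by rewrite alternating_partE !mxE !eqxx !diagHE.
have [<- | pq] := eqVneq p q; first by rewrite diagHE F2_mulxx F2_addxx.
have [p_i | pi] := eqVneq p i; have [q_i | qi] := eqVneq q i.
- by rewrite p_i q_i eqxx in pq.
- by rewrite p_i symmetric_entry // symmetric3_column // [1 + true%:R]F2_addxx mul0r !addr0.
- by rewrite q_i symmetric3_column // [1 + true%:R]F2_addxx mulr0 !addr0.
by have [_ ->] := symmetric3_offdiag pi qi pq; rewrite !addr0 add0r mulr1 F2_addxx.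
Qed.

End Symmetric3.

Lemma symmetric3_noncharacteristic_unit_vector (H : 'M[F2]_3) :
    H^T = H -> H \in unitmx -> diagv H != 0 -> alternating_part (1%:M + H) != 0 ->
  exists y, noncharacteristic_unit_vector H y.
Proof.
move=> symH uH nzH; set h := diagv (invmx H).
have delta_dot i (v : 'rV[F2]_3) : dotv 'e_i v = v 0 i by rewrite dotvC dotv_delta.
case: (pickP (fun i => (h 0 i == 1) && ('e_i != diagv H))) => [i | none].
  case/andP=> hi ei _; exists 'e_i.
  rewrite /noncharacteristic_unit_vector !delta_dot -/h hi ei mxE !eqxx andbT /=.
  apply/eqP => /rowP/(_ (i + 1)); rewrite !mxE /=.
  by case: i {hi ei} => [[|[|[|]]]].
have only i : h 0 i = 1 -> diagv H = 'e_i.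
  by move=> /eqP hi; have /negbT := none i; rewrite hi negbK => /eqP.
have /rV0Pn[i] := diagv_invmx_neq0 symH uH nzH; rewrite -/h F2_neq0 => /eqP hi.
case/eqP; apply: (@symmetric3_alternating_part_eq0 _ i) => //; first exact: only.
apply/rowP => j; rewrite [RHS]mxE -/h; have [-> // | neqij] := eqVneq j i.
have [-> // | /only] := F2P (h 0 j); rewrite (only i hi) => /rowP/(_ i).
by rewrite !mxE !eqxx eq_sym (negPf neqij) => /eqP.
Qed.

Lemma exists_peeling_vector k (G : 'M[F2]_(1 + k)) (H := 1%:M + G)
    (B := alternating_part G) :
    G^T = G -> H \in unitmx -> diagv H != 0 -> ((1 < k)%N -> B != 0) ->
  exists y, [/\ dotv y y = 1, dotv y (diagv (invmx H)) = 1,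
    (k == 0%N) || (y != const_mx 1) && (y != diagv H)
    & (2 < k)%N -> B != vsq y *m B + B *m vsq y].
Proof.
move=> symG uH nzH nzB; have symH : H^T = H by rewrite symmetric_add ?trmx1.
case: k => [|[|[|k]]] in G H B symG symH uH nzH nzB *.
- have [y [yy yh _]] := @unit_vector_notin _ H [::] symH uH nzH isT.
  by exists y.
- have [|y /and4P[/eqP yy /eqP yh y1 yd] _] :=
    @noncharacteristic_unit_vector_notin _ H [::] symH uH nzH; first by [].
  by exists y; rewrite y1 yd.
- have [|y /and4P[/eqP yy /eqP yh y1 yd]] :=
    @symmetric3_noncharacteristic_unit_vector H symH uH nzH.
    by rewrite addrA addmxx_F2 add0r nzB.
  by exists y; rewrite y1 yd.
have [s size_s sB] := vsq_splitting_candidates (symmetric_alternating_part symG) (nzB isT).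
have [|y /and4P[/eqP yy /eqP yh y1 yd] ys] :=
    @noncharacteristic_unit_vector_notin _ H s symH uH nzH.
  have bound j : (3 + (odd j).*2 < 2 ^ j.+2)%N.
    case: j => // j; apply: (@leq_ltn_trans 5); first by case: (odd _).
    by apply: (@leq_trans (2 ^ 3)); rewrite // leq_exp2l.
  by rewrite size_s /= !negbK.
exists y; split=> //; first by rewrite y1 yd.
by move=> _; apply: contra ys => /eqP/sB.
Qed.

(** * Short walks *)

Definition gdist_le n (A B : 'M[F2]_n) k : Prop := exists2 j, (j <= k)%N & walk j A B.

Lemma gdist_le_add_vsq n (A B : 'M[F2]_n) z k :
  sgl A -> gdist_le A B k -> gdist_le (A + vsq z) B k.+1.
Proof.
move=> sA [j le_jk wj]; have [-> | nz] := eqVneq z 0.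
  by exists j; [exact: leqW | rewrite /vsq mulmx0 addr0].
by exists j.+1 => //; exists A; rewrite addrC addKr rank_vsq.
Qed.

Definition flat m n (T : 'M[F2]_(m, n)) : bool := alternating_part (T *m T^T) == 0.

Lemma flatP m n (T : 'M[F2]_(m, n)) :
  reflect (forall u v : 'rV_n, (u <= T)%MS -> (v <= T)%MS -> dotv u v = dotv u u * dotv v v)
          (flat T).
Proof.
have altE (a b : 'rV_m) : dotv (a *m alternating_part (T *m T^T)) b =
    dotv (a *m T) (b *m T) + dotv (a *m T) (a *m T) * dotv (b *m T) (b *m T).
  have dotT (c d : 'rV_m) : dotv (c *m T) (d *m T) = dotv (c *m (T *m T^T)) d.
    by rewrite dotvC dotv_mull -mulmxA dotvC.
  rewrite !dotT mulmxDr dotvDl mul_vsq dotvZl !dotv_diagv ?trmx_mul ?trmxK //.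
  by rewrite (dotvC b).
apply: (iffP eqP) => [flatT u v /submxP[a ->] /submxP[b ->] | flatT].
  by apply/eqP; rewrite -F2_addr_eq0 -altE flatT mulmx0 dot0v.
apply/row_matrixP => i; rewrite row0 rowE; apply: dotv_inj => b.
by rewrite altE flatT ?submxMl // F2_addxx dot0v.
Qed.

Lemma flatS m1 m2 n (S : 'M[F2]_(m1, n)) (T : 'M[F2]_(m2, n)) :
  (S <= T)%MS -> flat T -> flat S.
Proof.
move=> leST /flatP flatT; apply/flatP => u v uS vS.
by apply: flatT; apply: submx_trans leST.
Qed.

Lemma gram_gdist_le k n (T : 'M[F2]_(k, n)) (H := 1%:M + T *m T^T) :
    1%:M + T^T *m T \in unitmx -> (k == 0%N) || (diagv H != 0) ->
    ((2 < k)%N -> ~~ flat T) ->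
  gdist_le (1%:M + T^T *m T) 1%:M k.
Proof.
elim: k => [|k IHk] in T H * => uA nzH nflat.
  exists 0%N => //=; suff -> : T^T *m T = 0 by rewrite addr0.
  by rewrite [T]flatmx0 mulmx0.
have symG := symmetric_mul_tr T.
have symH : H^T = H by rewrite symmetric_add ?trmx1.
have uH : H \in unitmx by exact: unit_1addmxC.
have [y [yy yh neqy nsplit]] := @exists_peeling_vector k _ symG uH nzH nflat.
have [||Q yQ] := @orthonormal_completion k 1%:M y (trmx1 _ _) (unitmx1 _ _).
- by rewrite mulmx1.
- by rewrite mulmx1 diagv1; case: (k == 0)%N neqy => //= /andP[].
rewrite mulmx1 in yQ; set T1 := Q *m T.
have uA1 : 1%:M + T1^T *m T1 \in unitmx.
  apply: unit_1addmxC; rewrite (hyperplane_add1_gram yQ); apply: (hyperplane_unitmx yQ) => //.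
  by rewrite dotv_diagv ?symmetric_invmx.
rewrite (tr_mul_orthonormal_split yQ) addrA; apply: gdist_le_add_vsq.
  by rewrite /sgl uA1 linearD /= trmx1 trmx_mul trmxK eqxx.
apply: IHk => //.
  case: (k == 0%N) neqy => //= /andP[_ neqd]; rewrite (hyperplane_add1_gram yQ).
  by apply: (hyperplane_diagv_neq0 yQ) => //; rewrite eq_sym.
move=> k_gt2; apply/negP => /eqP; rewrite trmx_mul mulmxA -(mulmxA Q) alternating_part_congr //.
move/(hyperplane_form_eq0 yQ) => BE; case/eqP: (nsplit k_gt2); apply: BE.
by rewrite dotv_diagv ?symmetric_alternating_part // diagv_alternating_part dotv0.
Qed.

(** * Parity extension *)

Lemma dotv_under n (y z : 'rV[F2]_n.+1) :
  dotv y z = dotv (under y) (under z) + y 0 ord_max * z 0 ord_max.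
Proof.
rewrite !dotv_sum big_ord_recr /=; congr (_ + _).
by apply: eq_bigr => i _; rewrite !mxE.
Qed.

Lemma eq_row_under n (y z : 'rV[F2]_n.+1) :
  under y = under z -> y 0 ord_max = z 0 ord_max -> y = z.
Proof.
move=> /rowP eq_u eq_last; apply/rowP => j; have [i -> | -> //] := unliftP ord_max j.
have -> : lift ord_max i = widen_ord (leqnSn n) i by apply/val_inj; apply: lift_max.
by have := eq_u i; rewrite !mxE.
Qed.

Definition parity_mx n : 'M[F2]_(n, n.+1) :=
  \matrix_(i, j) (if unlift ord_max j is Some h then (i == h)%:R else 1).

Lemma under_parity n (u : 'rV[F2]_n) : under (u *m parity_mx n) = u.
Proof.
have lift_widen j : widen_ord (leqnSn n) j = lift ord_max j.
  by apply/val_inj/esym; apply: lift_max.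
apply/rowP => j; rewrite !mxE (bigD1 j) //= mxE lift_widen liftK eqxx mulr1.
by rewrite big1 ?addr0 // => i /negPf neqij; rewrite mxE liftK neqij mulr0.
Qed.

Lemma parity_last n (u : 'rV[F2]_n) : (u *m parity_mx n) 0 ord_max = dotv u u.
Proof.
rewrite dotvv dotv_sum mxE; apply: eq_bigr => i _.
by rewrite !mxE unlift_none.
Qed.

Lemma parity_under n (y : 'rV[F2]_n.+1) : dotv y y = 0 -> under y *m parity_mx n = y.
Proof.
move=> yy; apply: eq_row_under; first exact: under_parity.
by apply/eqP; rewrite parity_last -F2_addr_eq0 -[y 0 _]F2_mulxx -dotv_under yy.
Qed.

Lemma row_free_parity n : row_free (parity_mx n).
Proof.
apply: inj_row_free => u u0; rewrite -[u]under_parity u0.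
by apply/rowP => j; rewrite !mxE.
Qed.

Lemma dotv_parity n (u v : 'rV[F2]_n) :
  dotv (u *m parity_mx n) (v *m parity_mx n) = dotv u v + dotv u u * dotv v v.
Proof. by rewrite dotv_under !under_parity !parity_last. Qed.

Lemma flat_parity m n (T : 'M[F2]_(m, n)) :
  flat T = (T *m parity_mx n *m (T *m parity_mx n)^T == 0).
Proof.
congr (_ == 0); apply/matrixP => i j; rewrite !mulmx_tr_entry !row_mul dotv_parity.
by rewrite alternating_partE !mulmx_tr_entry.
Qed.

Lemma flat_maximal n (D : 'M[F2]_n) (z : 'rV_n) : flat D -> n.+1 = (\rank D + \rank D)%N ->
    (forall u, (u <= D)%MS -> dotv z u = dotv z z * dotv u u) ->
  (z <= D)%MS.
Proof.
rewrite flat_parity => /eqP DD rkD zD; rewrite -(submxMfree _ _ (row_free_parity n)).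
rewrite -(self_orthogonal_ker DD) ?mxrankMfree ?row_free_parity //.
apply/sub_kermxP/rowP => i; rewrite mulmx_tr_entry row_id row_mul dotv_parity mxE.
by rewrite zD ?row_sub // F2_addxx.
Qed.

Lemma flat_maximal_ones n (D : 'M[F2]_n) : flat D -> n.+1 = (\rank D + \rank D)%N ->
  ((const_mx 1 : 'rV_n) <= D)%MS.
Proof.
move=> flatD rkD; apply: flat_maximal => // u _.
have odd_n := odd_succ_double rkD.
by rewrite dotv_const1 F2_natr odd_n mul1r dotvC -dotvv.
Qed.

(** * Distance to the identity *)

Lemma gram_add_vsq n r (D : 'M[F2]_n) z : D^T = D -> \rank D = r ->
  exists T : 'M_(1 + r, n), exists a : 'rV_(1 + r),
    [/\ T^T *m T = D + vsq z, a *m T = z & dotv a a = 1].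
Proof.
move=> symD rkD; have [X [S [DE _ symS uS]]] := symmetric_rank_factor symD rkD.
have [|||R SR] := @unit_nonalternating_gram (1 + r) (block_mx 1%:M 0 0 S).
- by rewrite tr_block_mx symS !trmx0 trmx1.
- by rewrite block_diag_mx_unit unitmx1.
- rewrite diagv_block row_mx_eq0 negb_and diagv1; apply/orP; left.
  by apply/eqP => /rowP/(_ 0); rewrite !mxE.
exists (R *m col_mx z X), (row_mx 1%:M 0 *m R^T).
have eS : row_mx 1%:M 0 *m R^T *m R = row_mx 1%:M 0 :> 'rV_(1 + r).
  by rewrite -mulmxA -SR mul_row_block !(mul0mx, mulmx0, addr0) mul1mx.
split.
- rewrite trmx_mul mulmxA -(mulmxA _ R^T) -SR tr_col_mx mul_row_block mul_row_col.
  by rewrite !mulmx0 addr0 add0r mulmx1 addrC DE.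
- by rewrite mulmxA eS mul_row_col mul1mx mul0mx addr0.
by rewrite /dotv trmx_mul trmxK mulmxA eS tr_row_mx mul_row_col trmx1 mulmx1 mul0mx addr0 mxE.
Qed.

Lemma diagv_add1_gram_neq0 n r (D : 'M[F2]_n) z (T : 'M_(r, n)) a :
    D^T = D -> 1%:M + D \in unitmx -> dotv z (diagv (invmx (1%:M + D))) = 0 ->
    T^T *m T = D + vsq z -> a *m T = z -> dotv a a = 1 ->
  diagv (1%:M + T *m T^T) != 0.
Proof.
move=> symD uA zh TT aT aa; apply/eqP => H0.
have onesT : (const_mx 1 : 'rV[F2]_n) *m T^T = const_mx 1 :> 'rV_r.
  by apply/eqP; rewrite -addmx_eq0_F2 addrC -diagv1 -diagv_mul_tr -diagvD H0.
have zz : dotv z z = 1 by rewrite dotvv -aT dotv_mull onesT -dotvv.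
have : diagv (D + vsq z) = const_mx 1 *m (D + vsq z).
  by rewrite -TT mulmxA onesT -{2}[T]trmxK diagv_mul_tr trmxK.
rewrite diagvD diagv_vsq mulmxDr mul_vsq (dotvC _ z) -dotvv zz scale1r => /addIr dD.
have dA : diagv (1%:M + D) = const_mx 1 *m (1%:M + D).
  by rewrite diagvD diagv1 dD mulmxDr mulmx1.
have symA : (1%:M + D)^T = 1%:M + D by rewrite symmetric_add ?trmx1.
by move: zh; rewrite diagv_invmx // dA mulmxK // -dotvv zz => /eqP.
Qed.

Lemma nonflat_add_vsq_gdist_le n (D : 'M[F2]_n) z : D^T = D -> 1%:M + D \in unitmx ->
    dotv z (diagv (invmx (1%:M + D))) = 0 -> ~~ flat (col_mx z D) ->
  gdist_le (1%:M + D + vsq z) 1%:M (\rank D).+1.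
Proof.
move=> symD uA zh nflat; have [T [a [TT aT aa]]] := gram_add_vsq z symD erefl.
have DT : (D <= T)%MS.
  by rewrite -[D in (D <= _)%MS](addmxK_F2 _ (vsq z)) -TT -aT vsq_mul -mulmxDl submxMl.
rewrite -addrA -TT; apply: gram_gdist_le.
- by rewrite TT addrA unit_add_vsq // symmetric_add ?trmx1.
- by rewrite (diagv_add1_gram_neq0 symD uA zh TT aT aa).
by move=> _; apply: contra nflat; apply: flatS; rewrite col_mx_sub DT -aT submxMl.
Qed.

Lemma walk_gram k n (A : 'M[F2]_n) : sgl A -> walk k A 1%:M ->
  exists2 Z : 'M_(k, n), A = 1%:M + Z^T *m Z & flat Z -> Z *m Z^T = 0.
Proof.
elim: k A => [|k IHk] A sA /=.
  by move=> ->; exists 0; rewrite ?mulmx0 ?mul0mx ?addr0.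
case=> C [sC [rkC /(IHk _ sC)[Z CE ZZ]]].
have [/andP[/eqP symA uA] /andP[/eqP symC _]] := (sA, sC).
have [|z zE] := symmetric_rank1 _ rkC; first by rewrite linearB /= symA symC.
have AE : A = 1%:M + (col_mx z Z)^T *m col_mx z Z.
  by rewrite tr_col_mx mul_row_col -/(vsq z) addrCA -CE -zE subrK.
exists (col_mx z Z : 'M_(1 + k, n)) => // flatzZ.
have [z_zZ Z_zZ] := sub_col_mx z Z.
have {}ZZ : Z *m Z^T = 0 by apply: ZZ; apply: flatS flatzZ.
have zZ : z *m Z^T = 0.
  apply/rowP => i; rewrite mulmx_tr_entry mxE row_id.
  have /flatP -> // := flatzZ; last exact: submx_trans (row_sub i Z) Z_zZ.
  by rewrite -(mulmx_tr_entry Z Z) ZZ mxE mulr0.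
have zz : dotv z z = 0.
  (* Otherwise [z] is in the kernel of [A]. *)
  case: (F2P (dotv z z)) => // zz; suff z0 : z = 0 by rewrite z0 dot0v.
  apply: (can_inj (mulmxK uA)); rewrite mul0mx AE mulmxDr mulmx1.
  rewrite tr_col_mx mul_row_col mulmxDr -/(vsq z) mul_vsq zz scale1r mulmxA zZ mul0mx addr0.
  exact: addmxx_F2.
have Zz : Z *m z^T = 0 by rewrite -[Z *m z^T]trmxK trmx_mul trmxK zZ trmx0.
by rewrite (@tr_col_mx _ 1 k) (@mul_col_row _ 1 k n 1 k) mulmx_tr_rV zz zZ Zz ZZ raddf0
  block_mx0.
Qed.

Lemma flat_walk_ge k n (D : 'M[F2]_n) (u : 'rV_n) : sgl (1%:M + D) -> flat D ->
  (u <= D)%MS -> dotv u u = 1 -> walk k (1%:M + D) 1%:M -> (\rank D + 2 <= k)%N.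
Proof.
move=> sA flatD uD uu /(walk_gram sA)[Z /addrI DE ZZ]; rewrite leqNgt addn2 ltnS.
apply/negP => le_k; have leDZ : (D <= Z)%MS by rewrite DE submxMl.
have leZD : (Z <= D)%MS.
  have [_ <-] := mxrank_leqif_sup leDZ; rewrite eqn_leq mxrankS // leqNgt.
  apply/negP => ltDZ; have freeZ : row_free Z.
    by rewrite /row_free eqn_leq rank_leq_row (leq_trans _ ltDZ).
  by move: ltDZ; rewrite {1}DE mxrankMfree // mxrank_tr ltnn.
have /submxP[c uE] := submx_trans uD leDZ.
have: dotv u u = 0.
  by rewrite uE dotv_mull -mulmxA ZZ ?(flatS leZD) // mulmx0 dotv0.
by rewrite uu => /eqP.
Qed.

Section FlatSymmetric.

Variables (n : nat) (D : 'M[F2]_n).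
Hypotheses (symD : D^T = D) (flatD : flat D).

Let colsum : 'rV_n := const_mx 1 *m D.

Lemma flat_dotv_mul u v : dotv (u *m D) (v *m D) = dotv u colsum * dotv v colsum.
Proof.
have dotD w : dotv (w *m D) (w *m D) = dotv w colsum by rewrite dotvv dotv_mull symD.
by have /flatP -> := flatD; rewrite ?submxMl ?dotD.
Qed.

Lemma dotv_colsum : dotv colsum colsum = \tr D.
Proof.
by rewrite mxtrace_diagv dotvC -dotv_diagv // -dotvv.
Qed.

Lemma flat_colsum_mul : colsum *m D = \tr D *: colsum.
Proof.
apply: dotv_inj => w; rewrite dotvZl dotv_mull symD flat_dotv_mul -dotv_colsum.
by rewrite [dotv colsum colsum]dotvv (dotvC colsum) (dotvC colsum).
Qed.

Lemma flat_add1_unitmx : (1%:M + D \in unitmx) = (\tr D == 0).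
Proof.
apply/idP/eqP => [uA | trD0].
  case: (F2P (\tr D)) => // trD; have colsum0 : colsum = 0.
    apply: (can_inj (mulmxK uA)).
    by rewrite mul0mx mulmxDr mulmx1 flat_colsum_mul trD scale1r addmxx_F2.
  by rewrite -dotv_colsum colsum0 dot0v.
rewrite -row_free_unit; apply: inj_row_free => v; rewrite mulmxDr mulmx1 => /eqP.
rewrite addmx_eq0_F2 => /eqP vE.
have {}vE : v = dotv v colsum *: colsum.
  apply: dotv_inj => w.
  by rewrite {1}vE dotv_mull symD {1}vE flat_dotv_mul dotvZl (dotvC w).
have v_colsum : dotv v colsum = 0 by rewrite vE dotvZl dotv_colsum trD0 mulr0.
by rewrite vE v_colsum scale0r.
Qed.

Lemma flat_invmx_ones : 1%:M + D \in unitmx ->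
  dotv (const_mx 1) (diagv (invmx (1%:M + D))) = n%:R.
Proof.
move=> uA; have symA : (1%:M + D)^T = 1%:M + D by rewrite symmetric_add ?trmx1.
have trD0 : \tr D = 0 by apply/eqP; rewrite -flat_add1_unitmx.
have onesV : const_mx 1 *m invmx (1%:M + D) = const_mx 1 + colsum.
  apply: (canLR (mulmxK uA)); rewrite mulmxDr !mulmxDl !mulmx1 -/colsum.
  by rewrite flat_colsum_mul trD0 scale0r addr0 addmxK_F2.
rewrite -dotv_diagv ?symmetric_invmx // onesV dotvDl dotv_const1 -dotvv.
by rewrite dotv_colsum trD0 addr0.
Qed.

End FlatSymmetric.

Lemma nonflat_gdist_le n (D : 'M[F2]_n) :
    D^T = D -> 1%:M + D \in unitmx -> ~~ flat D ->
  gdist_le (1%:M + D) 1%:M (\rank D).+1.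
Proof.
move=> symD uA nflatD; have := nonflat_add_vsq_gdist_le symD uA (dot0v _).
rewrite /vsq mulmx0 addr0; apply.
by apply: contra nflatD; apply: flatS; apply: (sub_col_mx (0 : 'rV_n) D).2.
Qed.

Lemma flat_gdist_le n (D : 'M[F2]_n) : D^T = D -> 1%:M + D \in unitmx -> flat D ->
    (1 < n)%N -> n.+1 = (\rank D + \rank D)%N ->
  gdist_le (1%:M + D) 1%:M (\rank D + 2).
Proof.
move=> symD uA flatD n_gt1 rkD.
have odd_n := odd_succ_double rkD.
have [|||z zh nDz] := @orthogonal_notin _ _ _ D (diagv (invmx (1%:M + D))) (const_mx 1).
- exact: flat_maximal_ones.
- by rewrite mulmx_tr_rV flat_invmx_ones // F2_natr odd_n oner_neq0.
- rewrite -ltnS rkD -[(\rank D).+1]addn1 ltn_add2l -ltn_double -[(\rank D).*2]addnn -rkD.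
  exact: n_gt1.
have {}zh : dotv z (diagv (invmx (1%:M + D))) = 0 by rewrite /dotv zh mxE.
rewrite -[1%:M + D](addmxK_F2 _ (vsq z)) addn2; apply: gdist_le_add_vsq.
  by rewrite /sgl unit_add_vsq ?symmetric_add ?vsq_sym ?trmx1 ?eqxx.
apply: nonflat_add_vsq_gdist_le => //; apply: contra nDz => /flatP flat_zD.
have [z_zD D_zD] := sub_col_mx z D.
by apply: flat_maximal => // u uD; apply: flat_zD (submx_trans uD D_zD).
Qed.

Lemma in_SDP n (A : 'M[F2]_n) : (3 <= n)%N -> odd n ->
  in_SD A <-> [/\ sgl A, \rank (A - 1%:M) = (n + 1)./2 & flat (A - 1%:M)].
Proof.
move=> n_ge3 odd_n; set D := A - 1%:M; have AE : A = 1%:M + D by rewrite addrC subrK.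
rewrite /in_SD -/D AE (_ : (n + 5)./2 = ((n + 1)./2 + 2)%N); last by rewrite addn2 !addnS.
have n2m := double_half_odd odd_n.
have symD : sgl (1%:M + D) -> D^T = D.
  by case/andP=> /eqP; rewrite linearD /= trmx1 => /addrI.
split=> [[sA [[_ longA] rkD]] | [sA rkD flatD]].
  have /andP[_ uA] := sA; split=> //; apply/negPn/negP => nflatD.
  have [j le_j] := nonflat_gdist_le (symD sA) uA nflatD.
  by apply: longA; rewrite addn2 -rkD ltnS.
have /andP[_ uA] := sA; rewrite -rkD in n2m *.
have long j : walk j (1%:M + D) 1%:M -> (\rank D + 2 <= j)%N.
  apply: flat_walk_ge (flat_maximal_ones flatD n2m) _ => //.
  by rewrite dotv_const1 F2_natr odd_n.
split=> //; split=> //; split; last by move=> j lt_j /long; rewrite leqNgt lt_j.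
have [j le_j wj] := flat_gdist_le (symD sA) uA flatD (ltnW n_ge3) n2m.
by have -> : (\rank D + 2)%N = j by apply/eqP; rewrite eqn_leq long.
Qed.

(** * Self-dual codes *)

Definition row_code m N (M : 'M[F2]_(m, N)) : {set 'rV[F2]_N} := [set y | (y <= M)%MS].

Lemma mem_dual_row_code m N (M : 'M[F2]_(m, N)) y :
  (y \in dual_code (row_code M)) = (y <= kermx M^T)%MS.
Proof.
rewrite inE; apply/forall_inP/sub_kermxP => [yM | yM x].
  apply/rowP => i; rewrite mulmx_tr_entry row_id dotvC mxE.
  by apply/eqP; apply: yM; rewrite inE row_sub.
by rewrite inE => /submxP[c ->]; rewrite dotv_mull yM dotv0.
Qed.

Lemma self_dual_row_code m N (M : 'M[F2]_(m, N)) :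
  M *m M^T = 0 -> N = (\rank M + \rank M)%N -> self_dual (row_code M).
Proof.
move=> MM rkM; apply/setP => y.
by rewrite mem_dual_row_code inE (self_orthogonal_ker MM rkM).
Qed.

Lemma self_dual_row_code_orthogonal m N (M : 'M[F2]_(m, N)) :
  self_dual (row_code M) -> M *m M^T = 0.
Proof.
move=> sdM; apply/sub_kermxP/row_subP => i.
by rewrite -mem_dual_row_code -sdM inE row_sub.
Qed.

Definition parity_code m n (T : 'M[F2]_(m, n)) := row_code (T *m parity_mx n).

Lemma eq_parity_code m1 m2 n (S : 'M[F2]_(m1, n)) (T : 'M[F2]_(m2, n)) :
  (S :=: T)%MS -> parity_code S = parity_code T.
Proof. by move=> eqST; apply/setP => y; rewrite !inE (eqmxMr _ eqST). Qed.

Lemma parity_code_self_dual m n (T : 'M[F2]_(m, n)) :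
  flat T -> n.+1 = (\rank T + \rank T)%N -> self_dual (parity_code T).
Proof.
rewrite flat_parity => /eqP TT rkT.
by apply: self_dual_row_code; rewrite ?mxrankMfree ?row_free_parity.
Qed.

Definition shortened m n (B : 'I_m -> 'rV[F2]_n.+1) : 'M_(m, n) :=
  fam_mx (fun i => under (B i)).

Lemma is_basisP m N (C : {set 'rV[F2]_N}) (B : 'I_m -> 'rV_N) :
  is_basis C B <-> row_free (fam_mx B) /\ C = row_code (fam_mx B).
Proof.
split=> -[freeB CE]; split=> //; last by move=> y; rewrite CE inE.
by apply/setP => y; rewrite inE; apply/idP/idP => /CE.
Qed.

Lemma self_dual_basis m n (C : {set 'rV[F2]_n.+1}) (B : 'I_m -> 'rV_n.+1) :
    self_dual C -> is_basis C B ->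
  [/\ fam_mx B = shortened B *m parity_mx n, row_free (shortened B), flat (shortened B)
    & C = parity_code (shortened B)].
Proof.
move=> sdC /is_basisP[freeB CE]; rewrite {}CE in sdC *.
have BB := self_dual_row_code_orthogonal sdC.
have BE : fam_mx B = shortened B *m parity_mx n.
  apply/row_matrixP => i; rewrite row_mul !rowK parity_under //.
  by rewrite -(rowK B i) -mulmx_tr_entry BB mxE.
split=> //; last by rewrite /parity_code -BE.
  by rewrite /row_free -(mxrankMfree _ (row_free_parity n)) -BE.
by rewrite flat_parity -BE BB.
Qed.

Lemma mxtrace_gram m n (Y : 'M[F2]_(m, n)) :
  \tr (Y^T *m Y) = dotv (const_mx 1 *m Y) (const_mx 1 *m Y).
Proof.
by rewrite dotvv mxtrace_diagv -{3}[Y]trmxK -diagv_mul_tr trmxK.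
Qed.

Lemma even_last_parity m n (B : 'I_m -> 'rV[F2]_n.+1) (Y : 'M_(m, n)) :
  fam_mx B = Y *m parity_mx n -> even_last B = (\tr (Y^T *m Y) == 0).
Proof.
move=> BE; have Blast i : B i 0 ord_max = (Y *m Y^T) i i.
  by rewrite -(rowK B i) -/(fam_mx B) BE row_mul parity_last mulmx_tr_entry.
have -> : \tr (Y^T *m Y) = #|[set i | B i 0 ord_max == 1]|%:R.
  rewrite mxtrace_mulC -sumr_const [RHS]big_mkcond; apply: eq_bigr => i _.
  by rewrite inE -Blast; case: (F2P (B i 0 ord_max)) => ->.
by rewrite F2_natr /even_last; case: (odd _).
Qed.

Lemma A1E m n (B : 'I_m -> 'rV[F2]_n.+1) :
  A1 B = 1%:M + (shortened B)^T *m shortened B.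
Proof.
congr (_ + _); apply/matrixP => a b; rewrite summxE !mxE; apply: eq_bigr => i _.
by rewrite !mxE big_ord1 !mxE.
Qed.

Lemma A2E m n (B : 'I_m -> 'rV[F2]_n.+1) :
  A2 B = A1 B + vsq (const_mx 1 *m shortened B).
Proof.
congr (_ + vsq _); rewrite mulmx_sum_row; apply: eq_bigr => i _.
by rewrite rowK mxE scale1r.
Qed.

Lemma nonalternating_gram n r (D : 'M[F2]_n) : D^T = D -> \rank D = r -> diagv D != 0 ->
  exists Y : 'M_(r, n), D = Y^T *m Y.
Proof.
move=> symD rkD nzD; have [X [S [DE _ symS uS]]] := symmetric_rank_factor symD rkD.
have [|R SR] := unit_nonalternating_gram symS uS.
  apply: contra_neq nzD => S0.
  by rewrite DE -{2}[X]trmxK diagv_congr // S0 mul0mx.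
by exists (R *m X); rewrite trmx_mul mulmxA -(mulmxA _ R^T) -SR.
Qed.

Lemma alternating_gram n r (D : 'M[F2]_n) : D^T = D -> \rank D = r -> diagv D = 0 ->
  ~~ odd r /\ exists Y : 'M_(r, n), D = Y^T *m Y + vsq (const_mx 1 *m Y).
Proof.
move=> symD rkD D0; split.
  have [X [S [DE freeX symS uS]]] := symmetric_rank_factor symD rkD.
  apply: (alternating_unit_even symS uS); apply/eqP; rewrite -(mulmx_free_eq0 _ freeX).
  by rewrite -{1}[X]trmxK -diagv_congr // trmxK -DE D0.
have [T [_ [TT _ _]]] := gram_add_vsq 0 symD rkD.
move: TT; rewrite -[T]vsubmxK; move: (usubmx T) (dsubmx T) => q P.
rewrite {1}/vsq mulmx0 addr0 => TT.
have : (const_mx 1 : 'rV_(1 + r)) *m col_mx q P = 0.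
  by rewrite -[col_mx q P]trmxK -diagv_mul_tr trmxK TT.
have oneq : const_mx 1 *m q = q by rewrite [const_mx 1]mx11_scalar mxE mul1mx.
rewrite -row_mx_const mul_row_col oneq => /eqP; rewrite addmx_eq0_F2 => /eqP qE; exists P.
by rewrite -TT tr_col_mx mul_row_col -qE addrC.
Qed.

Lemma parity_code_basis m n (D : 'M[F2]_n) (Y : 'M[F2]_(m, n))
    (B := fun i => row i (Y *m parity_mx n)) :
    (D <= Y)%MS -> \rank D = m ->
  [/\ fam_mx B = Y *m parity_mx n, shortened B = Y & is_basis (parity_code D) B].
Proof.
move=> leDY rkD.
have freeY : row_free Y.
  by rewrite /row_free eqn_leq rank_leq_row -[leqLHS]rkD mxrankS.
have eqDY : (D :=: Y)%MS.
  by apply/eqmxP; rewrite -(mxrank_leqif_eq leDY).2 rkD eq_sym.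
have BE : fam_mx B = Y *m parity_mx n by apply/row_matrixP => i; rewrite rowK.
split=> //.
  by apply/row_matrixP => i; rewrite rowK /B row_mul under_parity.
apply/is_basisP; rewrite BE; split; last exact: eq_parity_code.
by rewrite /row_free mxrankMfree ?row_free_parity.
Qed.

Lemma in_FC_gram n (C : {set 'rV[F2]_n.+1}) (A : 'M[F2]_n) (m := (n + 1)./2) :
    self_dual C -> in_FC C A ->
  exists Y : 'M_(m, n), exists K : 'M_m, let D := Y^T *m K *m Y in
    [/\ [/\ A = 1%:M + D, D^T = D & \tr D = 0], (D :=: Y)%MS,
        row_free Y, flat Y & C = parity_code Y].
Proof.
move=> sdC; case=> [[B [basisB [evB ->]]] | [even_m [B [basisB ->]]]].
all: have [BE freeY flatY CE] := self_dual_basis sdC basisB.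
all: set Y := shortened B in BE freeY flatY CE.
all: exists Y.
  exists 1%:M; rewrite mulmx1; split=> //.
    split; [exact: A1E | by rewrite trmx_mul trmxK | ].
    by apply/eqP; rewrite -(even_last_parity BE).
  by rewrite -[Y^T]mulmx1; apply: congr_unit_eqmx; rewrite ?unitmx1.
exists (1%:M + vsq (const_mx 1)); split=> //; last first.
  apply: congr_unit_eqmx => //; apply: unit_add_vsq; rewrite ?trmx1 ?unitmx1 //.
  by rewrite invmx1 diagv1 dotv_const1 F2_natr (negPf even_m).
rewrite mulmxDr mulmx1 mulmxDl -vsq_mul; split.
- by rewrite A2E A1E addrA.
- by rewrite symmetric_add ?vsq_sym // trmx_mul trmxK.
by rewrite linearD /= mxtrace_gram [\tr (vsq _)]mxtrace_mulC mulmx_tr_rV mxtrace_scalar F2_addxx.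
Qed.

Lemma in_FCP n (C : {set 'rV[F2]_n.+1}) (A : 'M[F2]_n) : odd n ->
  self_dual C /\ in_FC C A <->
  [/\ sgl A, \rank (A - 1%:M) = (n + 1)./2, flat (A - 1%:M) & C = parity_code (A - 1%:M)].
Proof.
move=> odd_n; set m := (n + 1)./2; set D := A - 1%:M.
have AE : A = 1%:M + D by rewrite addrC subrK.
have n2m := double_half_odd odd_n.
split=> [[sdC FCA] | [/andP[/eqP symA uA] rkD flatD ->]].
  have [Y [K [[A_YKY symYKY trYKY] eqY freeY flatY CE]]] := in_FC_gram sdC FCA.
  have DE : D = Y^T *m K *m Y by rewrite /D A_YKY addrC addKr.
  rewrite -{}DE in A_YKY symYKY trYKY eqY.
  have flatD : flat D by apply: flatS flatY; rewrite eqY.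
  split=> //; first 1 last.
  - by rewrite eqY; apply/eqP.
  - by rewrite CE; apply: eq_parity_code; apply: eqmx_sym.
  by rewrite /sgl AE flat_add1_unitmx // trYKY eqxx symmetric_add ?trmx1 ?eqxx.
have symD : D^T = D by rewrite linearB /= symA trmx1.
split; first by apply: parity_code_self_dual; rewrite // rkD.
have trD : \tr D = 0 by apply/eqP; rewrite -flat_add1_unitmx // -AE.
have [D0 | nzD] := eqVneq (diagv D) 0.
  have [even_m [Y DE]] := alternating_gram symD rkD D0.
  have leDY : (D <= Y)%MS by rewrite DE vsq_mul -mulmxDl submxMl.
  have [BE YE basisB] := parity_code_basis leDY rkD.
  by right; split=> //; eexists; split; [exact: basisB | rewrite A2E A1E YE -addrA -DE].
have [Y DE] := nonalternating_gram symD rkD nzD.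
have leDY : (D <= Y)%MS by rewrite DE submxMl.
have [BE YE basisB] := parity_code_basis leDY rkD.
left; eexists; split; first exact: basisB.
by rewrite (even_last_parity BE) -DE trD A1E YE -DE.
Qed.

Theorem theorem8p3 (n : nat) (hn : (3 <= n)%N) (hodd : odd n) :
  (forall C : {set 'rV['F_2]_n.+1}, self_dual C ->
     forall A : 'M['F_2]_n, in_FC C A -> in_SD A)
  /\ (forall C C' : {set 'rV['F_2]_n.+1}, self_dual C -> self_dual C' -> C <> C' ->
        forall A : 'M['F_2]_n, ~ (in_FC C A /\ in_FC C' A))
  /\ (forall A : 'M['F_2]_n, in_SD A ->
        exists C : {set 'rV['F_2]_n.+1}, self_dual C /\ in_FC C A).
Proof.
split=> [C sdC A FCA | ].
  have [sA rkA flatA _] := (in_FCP C A hodd).1 (conj sdC FCA).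
  exact/in_SDP.
split=> [C C' sdC sdC' neqCC' A [FCA FC'A] | A /(in_SDP A hn hodd)[sA rkA flatA]].
  have [_ _ _ CE] := (in_FCP C A hodd).1 (conj sdC FCA).
  have [_ _ _ C'E] := (in_FCP C' A hodd).1 (conj sdC' FC'A).
  by apply: neqCC'; rewrite CE C'E.
by exists (parity_code (A - 1%:M)); apply/in_FCP.
Qed.
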